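(* Let $\mathcal{T}$ be a regular continuity type on $\mathsf{Ab(Top)}$ with associated closure operator $\mathfrak{f}$. Let $K$ be a compact Hausdorff abelian topological group, $A=\hat K$, and $H\leq K$ a subgroup. Put $\mathcal{T}_H(A)=\{\mathcal{F}\in\mathcal{T}(A)\mid \mathcal{F}\longrightarrow 0 \text{ in } (A,\tau_H)\}$. Then: (a) $\mathfrak{f}_K(H)=\{\chi\in K\mid \chi(\mathcal{F})\longrightarrow 0\text{ for all }\mathcal{F}\in\mathcal{T}_H(A)\}$; (b) $\mathfrak{f}_K(H)=\{\chi\in K\mid \chi\colon (A,\tau_H)\to\mathbb{T}\text{ is }\mathcal{T}\text{-continuous}\}$; (c) the identity homomorphism $(A,\tau_H)\to(A,\tau_{\mathfrak{f}_K(H)})$ is $\mathcal{T}$-continuous.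
   Context: $\mathbb{T}=\mathbb{R}/\mathbb{Z}$. $\mathsf{Ab(Top)}$ is the category of abelian topological groups (no separation axioms) and continuous homomorphisms; $\hat G$ is the Pontryagin dual of $G$. For a filter-base $\mathcal{F}$ and a map $\varphi$, $\varphi(\mathcal{F})=\{\varphi(F)\mid F\in\mathcal{F}\}$. A continuity type $\mathcal{T}$ on $\mathsf{Ab(Top)}$ assigns to each $G\in\mathsf{Ab(Top)}$ a collection $\mathcal{T}(G)$ of filter-bases on $G$ such that $\varphi(\mathcal{F})\in\mathcal{T}(G_2)$ for every continuous homomorphism $\varphi\colon G_1\to G_2$ and every $\mathcal{F}\in\mathcal{T}(G_1)$. It is regular if $\mathcal{T}(G)=\mathcal{T}(G_d)$ for every $G\in\mathsf{Ab(Top)}$, where $G_d$ is $G$ with the discrete topology. For a filter-base $\mathcal{F}$ on $\hat G$, put $z_{\mathcal{F}}(G)=\{\chi\in G\mid \chi(\mathcal{F})\longrightarrow 0\text{ in }\mathbb{T}\}$, where $\chi\in G$ is regarded as the character $x\mapsto x(\chi)$ of $\hat G$. The closure operator $\mathfrak{f}$ associated with $\mathcal{T}$ is given, for $H\leq G$, by $$\mathfrak{f}_G(H)=\bigcap\{z_{\mathcal{F}}(G)\mid \mathcal{F}\in\mathcal{T}(\hat G),\ H\leq z_{\mathcal{F}}(G)\}$$ (the empty intersection being $G$). A homomorphism $\varphi\colon G_1\to G_2$ (not necessarily continuous) between abelian topological groups is $\mathcal{T}$-continuous if $\varphi(\mathcal{F})\longrightarrow e$ in $G_2$ for every $\mathcal{F}\in\mathcal{T}(G_1)$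 with $\mathcal{F}\longrightarrow e$ in $G_1$. For a compact Hausdorff abelian group $K$ with (discrete) dual $A=\hat K$, elements of $K$ are identified with characters of $A$; for a subgroup $H\leq K$ (not necessarily closed), $\tau_H$ is the coarsest group topology on $A$ making every $\chi\colon A\to\mathbb{T}$ in $H$ continuous. *)

(* Defs.v *)
From HB Require Import structures.
From mathcomp Require Import all_boot all_order all_algebra.
From mathcomp Require Import generic_quotient ring_quotient.
From mathcomp Require Import all_classical all_reals topology normedtype.

Set Implicit Arguments.
Unset Strict Implicit.
Unset Printing Implicit Defensive.

Import Order.TTheory GRing.Theory Num.Theory numFieldNormedType.Exports.
Local Open Scope classical_set_scope.
Local Open Scope ring_scope.
Local Open Scope quotient_scope.

Section Circle.
Variable R : realType.

Definition integers : zmodClosed R :=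
  GRing.ZmodClosed.clone R (@Num.int_num_subdef R) _.

(* R / Z.  [quotient_topology] carries its own choice structure, so the group
   structure of [Quotient.quot] cannot be copied and is rebuilt from its laws. *)
Definition circle : Type := quotient_topology (Quotient.quot integers).

HB.instance Definition _ := Topological.on circle.
HB.instance Definition _ :=
  GRing.isZmodule.Build circle (@Quotient.addqA R integers)
    (@Quotient.addqC R integers) (@Quotient.add0q R integers)
    (@Quotient.addNq R integers).

Definition to_circle (x : R) : circle := \pi_(Quotient.quot integers) x.

Lemma to_circleB (x y : R) : to_circle (x - y) = to_circle x - to_circle y.
Proof.
exact: (raddfB (\pi_(Quotient.quot integers) : {additive R -> _})).
Qed.

Lemma to_circle_eq (x y : R) :
  to_circle x = to_circle y <-> x - y \is a Num.int.
Proof.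
split=> [xy|xy].
  suff: x - y \in integers by [].
  by rewrite Quotient.idealrBE; apply/eqP.
have : x - y \in integers by [].
by rewrite Quotient.idealrBE => /eqP.
Qed.

Lemma to_circle_surj (t : circle) : exists x, to_circle x = t.
Proof. by exists (repr (t : Quotient.quot integers)); rewrite /to_circle reprK. Qed.

Lemma to_circle_open (U : set R) : open U -> open (to_circle @` U).
Proof.
move=> oU; rewrite /open /= /quotient_open.
rewrite (_ : _ @^-1` _ = \bigcup_(n in [set n : R | n \is a Num.int])
    ((fun x => x - n) @^-1` U)); last first.
  apply/seteqP; split=> [x [u Uu ux]|x [n /= nint Un]].
    exists (x - u); last by rewrite /= subKr.
    by apply/to_circle_eq; rewrite ux.
  exists (x - n) => //; apply/to_circle_eq.
  by rewrite addrAC subrr add0r rpredN.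
apply: bigcup_open => n _; apply: open_comp => // x _.
by apply: cvgB; [exact: cvg_id|exact: cvg_cst].
Qed.

Lemma to_circle_continuous : continuous to_circle.
Proof. exact: pi_continuous. Qed.

Let circle_sub_continuous :
  continuous (fun x : circle * circle => x.1 - x.2).
Proof.
move=> [s t] /=; have [x <-] := to_circle_surj s.
have [y <-] := to_circle_surj t.
move=> A; rewrite /= -to_circleB => /to_circle_continuous nA.
have /(_ _ nA)[[P Q] /= [nP nQ] PQ] :=
  @sub_continuous (R : topologicalZmodType) (x, y).
have im (z : R) (B : set R) : nbhs z B -> nbhs (to_circle z) (to_circle @` B).
  rewrite nbhsE => -[C [oC Cz] CB]; rewrite nbhsE.
  exists (to_circle @` C); last exact: image_subset.
  by split; [exact: to_circle_open|exists z].
exists (to_circle @` P, to_circle @` Q); first by split; exact: im.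
move=> [_ _] [/= [p Pp <-] [q Qq <-]].
by rewrite -to_circleB; apply: (PQ (p, q)).
Qed.

HB.instance Definition _ :=
  PreTopologicalNmodule_isTopologicalZmodule.Build circle circle_sub_continuous.

End Circle.

Section TopologicalGroup.
Variable V : topologicalZmodType.

Lemma continuous_sub_fst_snd (X : topologicalType) (f : X -> V) (x y : X) :
  continuous f ->
  (fun p : X * X => f p.1 - f p.2) @ nbhs (x, y) --> f x - f y.
Proof.
move=> cf; apply: (@continuous2_cvg _ _ _ _ _ _ (fun p => f p.1)
  (fun p => f p.2) (fun s t => s - t)).
- exact: (@sub_continuous V (f x, f y)).
- exact: (@cvg_comp _ _ _ fst f _ _ _ cvg_fst (cf x)).
- exact: (@cvg_comp _ _ _ snd f _ _ _ cvg_snd (cf y)).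
Qed.

Lemma topologicalZmod_closure_nbhs (a : V) (P : set V) : nbhs a P ->
  exists2 Q, nbhs a Q & closure Q `<=` P.
Proof.
move=> nP; have := @sub_continuous V (a, 0) P.
rewrite /continuous_at /= subr0 => /(_ nP)[[Q N] /= [nQ nN] QN].
exists Q => // z /(_ ((fun y => y - z) @^-1` N))[].
  have : nbhs (z - z) N by rewrite subrr.
  apply: (@continuous_comp _ _ _ (fun y => (y, z)) (fun p : V * V => p.1 - p.2)).
    by apply: cvg_pair; [exact: cvg_id|exact: cvg_cst].
  exact: sub_continuous.
move=> y [Qy Ny]; have := QN (y, y - z) (conj Qy Ny).
by rewrite /= opprB addrC subrK.
Qed.

Lemma compact_open_sub_cvg (G : topologicalType) (f g : G -> V)
    (C : set G) (O : set V) : continuous f -> continuous g ->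
  compact C -> open O -> (f \- g) @` C `<=` O ->
  \forall h \near ((f : {compact-open, G -> V}), (g : {compact-open, G -> V})),
    ((h.1 : G -> V) \- (h.2 : G -> V)) @` C `<=` O.
Proof.
move=> cf cg cC oO fgO.
pose F := nbhs ((f : {compact-open, G -> V}), (g : {compact-open, G -> V})).
suff : \forall h \near F,
    C `<=` (fun x => O ((h.1 : G -> V) x - (h.2 : G -> V) x)).
  by apply: filterS => h hO _ [x Cx <-]; exact: hO.
have /compact_near_coveringP/near_covering_withinP ncC := cC.
apply: (ncC _ F (fun h x => O ((h.1 : G -> V) x - (h.2 : G -> V) x))) => u Cu.
have Ofg : nbhs (f u - g u) O.
  by apply: open_nbhs_nbhs; split => //; apply: fgO; exists u.
have [[P Q] /= [nP nQ] PQ] := @sub_continuous V (f u, g u) O Ofg.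
have shrink (k : G -> V) (B : set V) : continuous k -> nbhs (k u) B ->
    exists2 W, nbhs u W & \forall h \near (k : {compact-open, G -> V}),
      forall y, C y -> W y -> B ((h : G -> V) y).
  move=> ck nB; have [D nD DB] := topologicalZmod_closure_nbhs (nbhs_interior nB).
  exists (k @^-1` D); first exact: ck.
  have cK : compact (C `&` closure (k @^-1` D)).
    by apply: compact_closedI => //; exact: closed_closure.
  have kK : k @` (C `&` closure (k @^-1` D)) `<=` B°.
    move=> _ [y [_ Dy] <-]; apply: DB => E /(ck y)/Dy[z [Dz Ez]].
    by exists (k z).
  have := open_nbhs_nbhs (conj (compact_open_open cK (@open_interior _ B)) kK).
  apply: filterS => h hK y Cy Dy; apply: interior_subset; apply: hK.
  by exists y => //; split => //; exact: subset_closure.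
have [W nW fW] := shrink f P cf nP; have [W' nW' gW] := shrink g Q cg nQ.
exists (W `&` W', [set h | (forall y, C y -> W y -> P ((h.1 : G -> V) y)) /\
    (forall y, C y -> W' y -> Q ((h.2 : G -> V) y))]).
  split; first exact: filterI.
  by exists ([set h | forall y, C y -> W y -> P ((h : G -> V) y)],
    [set h | forall y, C y -> W' y -> Q ((h : G -> V) y)]).
move=> [y h] /= [[Wy W'y] [hP hQ]] Cy.
by apply: (PQ (h.1 y, h.2 y)); split => /=; [exact: hP|exact: hQ].
Qed.

End TopologicalGroup.

Section Dual.
Variables (R : realType) (G : topologicalZmodType).

Definition character : {pred G -> circle R} :=
  fun f => `[< zmod_morphism f /\ continuous f >].

Let character_zmod_closed : zmod_closed character.
Proof.
split=> [|f g /asboolP[addf cf] /asboolP[addg cg]]; apply/asboolP; split.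
- by move=> x y /=; rewrite subr0.
- by move=> x; exact: cvg_cst.
- move=> x y; rewrite -[LHS]/(f (x - y) - g (x - y)) addf addg.
  rewrite -[RHS]/((f x - g x) - (f y - g y)).
  by rewrite !opprD !opprK !addrA (addrAC (f x)).
- move=> x; apply: (@continuous2_cvg _ _ _ _ _ _ f g (fun s t => s - t)).
  + exact: (@sub_continuous (circle R) (f x, g x)).
  + exact: cf.
  + exact: cg.
Qed.

HB.instance Definition _ :=
  GRing.isZmodClosed.Build (G -> circle R) character character_zmod_closed.

Record dual := Dual {
  dual_fun :> G -> circle R ;
  dual_character : dual_fun \in character
}.

HB.instance Definition _ := [isSub for dual_fun].
HB.instance Definition _ := [Choice of dual by <:].
HB.instance Definition _ := [SubChoice_isSubZmodule of dual by <:].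

(* The compact-open topology; it is discrete when G is compact. *)
HB.instance Definition _ := Topological.copy dual
  (initial_topology (dual_fun : dual -> {compact-open, G -> circle R})).

Lemma dualB (x : dual) : zmod_morphism x.
Proof. by case: x => f /= /asboolP[]. Qed.

Lemma dual_continuous (x : dual) : continuous x.
Proof. by case: x => f /= /asboolP[]. Qed.

Let dual_sub_continuous : continuous (fun p : dual * dual => p.1 - p.2).
Proof.
pose incl : dual -> {compact-open, G -> circle R} := dual_fun.
apply: (@continuous_comp_initial dual _ _ incl) => -[x y].
apply/compact_open_cvgP => C O cC oO xyO.
have [[A B] /= [nA nB] AB] := compact_open_sub_cvg
  (@dual_continuous x) (@dual_continuous y) cC oO xyO.
exists (incl @^-1` A, incl @^-1` B) => /=.
  by split; exact: (@initial_continuous dual _ incl).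
by move=> [u v] [/= Au Bv]; exact: (AB (incl u, incl v)).
Qed.

HB.instance Definition _ :=
  PreTopologicalNmodule_isTopologicalZmodule.Build dual dual_sub_continuous.

(* An element of G seen as a character of its dual. *)
Definition ev (chi : G) : dual -> circle R := fun x => x chi.

Lemma ev_is_zmod_morphism chi : zmod_morphism (ev chi).
Proof. by []. Qed.

HB.instance Definition _ chi :=
  GRing.isZmodMorphism.Build dual (circle R) (ev chi)
    (ev_is_zmod_morphism chi).

End Dual.

(* Continuity of subtraction amounts to continuity of both group operations. *)
Definition group_topology (A : zmodType) (t : Topological A) : Prop :=
  let At : topologicalType := Topological.Pack t in
  continuous (fun p : At * At => ((p.1 : A) - (p.2 : A) : At)).

(* The dual of G with the coarsest group topology for which the evaluations at
   the points of H are continuous: a set is open when it is open for all such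
   group topologies.  That this is again such a topology is given by
   [ev_weak_dual_continuous] and the [topologicalZmodType] instance below. *)
Definition weak_dual (R : realType) (G : topologicalZmodType) (H : set G) :
  Type := dual R G.

Section WeakDual.
Variables (R : realType) (G : topologicalZmodType) (H : set G).
Local Notation weak_dual := (weak_dual R H).

HB.instance Definition _ := GRing.Zmodule.on weak_dual.

Definition weak_dual_open (U : set weak_dual) : Prop :=
  forall t : Topological weak_dual, group_topology t ->
    (forall chi, H chi ->
      continuous (ev chi : Topological.Pack t -> circle R)) ->
    @open (Topological.Pack t) U.

Let weak_dual_openT : weak_dual_open setT.
Proof. by move=> t _ _; exact: openT. Qed.

Let weak_dual_openI : setI_closed weak_dual_open.
Proof. by move=> U V oU oV t gt ct; apply: openI; [exact: oU|exact: oV]. Qed.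

Let weak_dual_open_bigU (I : Type) (U : I -> set weak_dual) :
  (forall i, weak_dual_open (U i)) -> weak_dual_open (\bigcup_i U i).
Proof. by move=> oU t gt ct; apply: bigcup_open => i _; exact: oU. Qed.

HB.instance Definition _ := isOpenTopological.Build weak_dual
  weak_dual_openT weak_dual_openI weak_dual_open_bigU.

Lemma ev_weak_dual_continuous (chi : G) : H chi ->
  continuous (ev chi : weak_dual -> circle R).
Proof.
move=> Hchi; apply/continuousP => U oU.
suff : weak_dual_open (ev chi @^-1` U) by [].
by move=> t _ ct; apply: (iffLR (continuousP _) (ct _ Hchi)).
Qed.

Lemma weak_dual_coarsest (t : Topological weak_dual) : group_topology t ->
  (forall chi, H chi ->
    continuous (ev chi : Topological.Pack t -> circle R)) ->
  @open weak_dual `<=` @open (Topological.Pack t).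
Proof. by move=> gt ct U; apply. Qed.

Let initial_dual := sup_topology (fun i : {chi | H chi} =>
  Topological.class (initial_topology (ev (sval i) : weak_dual -> circle R))).

Let initial_dual_cvgP (F : set_system weak_dual) (x : weak_dual) : Filter F ->
  F --> (x : initial_dual) <->
  forall chi, H chi -> ev chi @ F --> ev chi x.
Proof.
move=> FF; split=> [/cvg_sup Fx chi Hchi U nU|Fx].
  apply: (Fx (exist _ chi Hchi)).
  exact: (@initial_continuous _ _ (ev chi : weak_dual -> circle R)).
apply/cvg_sup => -[chi Hchi] U /= [_ [[V oV <-] Vx] VU].
by apply: filterS VU _; apply: (Fx _ Hchi); exact: open_nbhs_nbhs.
Qed.

Let ev_initial_dual_continuous (chi : G) : H chi ->
  continuous (ev chi : initial_dual -> circle R).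
Proof.
move=> Hchi z; exact: (iffLR (@initial_dual_cvgP _ z
  (@nbhs_filter initial_dual z)) (fun U nU => nU) _ Hchi).
Qed.

Let group_topology_initial_dual : group_topology (Topological.class initial_dual).
Proof.
move=> [x y]; apply/initial_dual_cvgP => chi Hchi.
exact: (continuous_sub_fst_snd (ev_initial_dual_continuous Hchi)).
Qed.

Lemma weak_dual_cvgP (F : set_system weak_dual) (x : weak_dual) : Filter F ->
  F --> x <-> forall chi, H chi -> ev chi @ F --> ev chi x.
Proof.
move=> FF; split=> [Fx chi Hchi|Fx U].
  exact: (@cvg_comp _ _ _ id (ev chi) _ _ _ Fx
    (ev_weak_dual_continuous Hchi (x := x))).
rewrite nbhsE => -[V [oV Vx] VU]; apply: filterS VU _.
have oV' : @open initial_dual V.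
  apply: oV; first exact: group_topology_initial_dual.
  exact: ev_initial_dual_continuous.
by apply: ((iffRL (@initial_dual_cvgP F x FF)) Fx); exact: open_nbhs_nbhs.
Qed.

Let weak_dual_sub_continuous :
  continuous (fun p : weak_dual * weak_dual => p.1 - p.2).
Proof.
move=> [x y]; apply/weak_dual_cvgP => chi Hchi.
exact: (continuous_sub_fst_snd (ev_weak_dual_continuous Hchi)).
Qed.

HB.instance Definition _ := PreTopologicalNmodule_isTopologicalZmodule.Build
  weak_dual weak_dual_sub_continuous.

End WeakDual.

Arguments weak_dual R {G} H.

Section DiscreteGroup.
Variable G : zmodType.

HB.instance Definition _ := GRing.Zmodule.copy (discrete_topology G) G.

Let discrete_sub_continuous : continuous
  (fun p : discrete_topology G * discrete_topology G => p.1 - p.2).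
Proof.
move=> [x y] U /nbhs_singleton Uxy; exists ([set x], [set y]) => /=.
  by split; exact: discrete_set1.
by move=> [_ _] [/= -> ->].
Qed.

HB.instance Definition _ := PreTopologicalNmodule_isTopologicalZmodule.Build
  (discrete_topology G) discrete_sub_continuous.

End DiscreteGroup.

Definition is_filter_base (T : Type) (B : set (set T)) : Prop :=
  [/\ B !=set0, ~ B set0 &
      forall U V, B U -> B V -> exists2 W, B W & W `<=` U `&` V].

Definition base_cvg (X : topologicalType) (B : set (set X)) (x : X) : Prop :=
  filter_from B id --> x.

(* The space is explicit: the types [dual], [weak_dual] and [discrete_topology]
   share their carrier, so that it could be inferred wrongly. *)
Arguments base_cvg : clear implicits.

Definition base_image (S T : Type) (f : S -> T) (B : set (set S)) :
  set (set T) := [set f @` U | U in B].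

(* [topologicalZmodType] also packs a choice function; by [ct_image] applied to
   identity maps, the value at G only depends on the topological group. *)
Record continuity_type := ContinuityType {
  ct_bases :> forall G : topologicalZmodType, set (set (set G)) ;
  ct_filter_base : forall (G : topologicalZmodType) B,
    @ct_bases G B -> is_filter_base B ;
  ct_image : forall (G1 G2 : topologicalZmodType) (f : {additive G1 -> G2}) B,
    continuous f -> @ct_bases G1 B -> @ct_bases G2 (base_image f B)
}.

Arguments ct_bases : clear implicits.

Definition regular_type (T : continuity_type) : Prop :=
  forall G : topologicalZmodType, T G = T (discrete_topology G).

Definition type_continuous (T : continuity_type) (G1 G2 : topologicalZmodType)
    (f : {additive G1 -> G2}) : Prop :=
  forall B, T G1 B -> base_cvg G1 B 0 -> base_cvg G2 (base_image f B) 0.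

Definition is_subgroup (G : zmodType) (H : set G) : Prop :=
  H 0 /\ forall x y, H x -> H y -> H (x - y).

Section ClosureOperator.
Variables (R : realType) (T : continuity_type) (G : topologicalZmodType).

Definition zero_set (B : set (set (dual R G))) : set G :=
  [set chi | base_cvg (circle R) (base_image (ev chi) B) 0].

Definition type_closure (H : set G) : set G :=
  \bigcap_(B in [set B | T (dual R G) B /\ H `<=` zero_set B]) zero_set B.

Definition null_bases (H : set G) : set (set (set (dual R G))) :=
  [set B | T (dual R G) B /\ base_cvg (weak_dual R H) B 0].

End ClosureOperator.

Arguments type_closure R T {G} H.
Arguments null_bases R T {G} H.

(* Main.v *)
(* Evaluations at points of [H] determine convergence in tau_H, so a filter base
   converges to 0 in tau_H exactly when [H] is contained in its zero set; this
   turns the definition of the closure into (a).  Regularity makes the filter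
   bases allowed by the type independent of the topology on the dual, which
   gives (b) and (c). *)
Require Import Defs.
From HB Require Import structures.
From mathcomp Require Import all_boot all_order all_algebra.
From mathcomp Require Import all_classical all_reals topology normedtype.
Import GRing.Theory.
Local Open Scope classical_set_scope.
Local Open Scope ring_scope.

Lemma filter_base_filter (T : Type) (B : set (set T)) :
  is_filter_base B -> Filter (filter_from B id).
Proof. by move=> [B0 _ BI]; apply: filter_from_filter. Qed.

Lemma filter_from_base_image (S T : Type) (f : S -> T) (B : set (set S)) :
  filter_from (base_image f B) id = f @ filter_from B id.
Proof.
apply/seteqP; split=> [U [_ [V BV <-] VU]|U [V BV VU]].
  by exists V => // x Vx; apply: VU; exists x.
by exists (f @` V); [exists V|move=> _ [x Vx <-]; exact: VU].
Qed.

Lemma base_image_id (T : Type) (B : set (set T)) : base_image idfun B = B.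
Proof.
by rewrite /base_image; under eq_fun do rewrite image_id; rewrite image_id.
Qed.

(** By [weak_dual_cvgP], tau_H-convergence is tested on the evaluations at [H], all of which vanish
    at 0. *)
Lemma base_cvg_weak_dual (R : realType) (K : topologicalZmodType) (H : set K)
    (B : set (set (dual R K))) : is_filter_base B ->
  base_cvg (weak_dual R H) B 0 <-> H `<=` zero_set B.
Proof.
move=> /filter_base_filter FB; rewrite /base_cvg.
have ev0 chi : ev chi (0 : weak_dual R H) = 0 :> circle R by [].
split=> [/weak_dual_cvgP B0 chi /B0|HB].
  by rewrite ev0 /zero_set /= /base_cvg filter_from_base_image.
apply/weak_dual_cvgP => chi /HB.
by rewrite ev0 /zero_set /= /base_cvg filter_from_base_image.
Qed.

(** Both groups have the same discretization, where regularity computes the two values. *)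
Lemma regular_weak_dual (R : realType) (T : continuity_type)
    (K : topologicalZmodType) (H : set K) :
  regular_type T -> T (weak_dual R H) = T (dual R K).
Proof. by move=> rT; rewrite (rT (weak_dual R H)) (rT (dual R K)). Qed.

Lemma null_basesP (R : realType) (T : continuity_type)
    (K : topologicalZmodType) (H : set K) (B : set (set (dual R K))) :
  null_bases R T H B <-> T (dual R K) B /\ H `<=` zero_set B.
Proof.
by split=> -[TB HB]; split=> //; apply/base_cvg_weak_dual => //;
  exact: ct_filter_base TB.
Qed.

Lemma type_closureE (R : realType) (T : continuity_type)
    (K : topologicalZmodType) (H : set K) :
  type_closure R T H = [set chi | forall B, null_bases R T H B ->
    base_cvg (circle R) (base_image (ev chi) B) 0].
Proof.
by apply/seteqP; split=> chi Hchi B /null_basesP; exact: Hchi.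
Qed.

Theorem lemma2p9 (R : realType) (T : continuity_type)
    (K : topologicalZmodType) (H : set K) :
  regular_type T -> compact [set: K] -> hausdorff_space K -> is_subgroup H ->
  [/\ type_closure R T H =
        [set chi | forall B, null_bases R T H B ->
           base_cvg (circle R) (base_image (ev chi) B) 0],
      type_closure R T H =
        [set chi | type_continuous T
           (ev chi : {additive weak_dual R H -> circle R})]
    & type_continuous T (idfun :
        {additive weak_dual R H -> weak_dual R (type_closure R T H)})].
Proof.
move=> rT _ _ _; split; first exact: type_closureE.
  (* For (b), the two conditions on [chi] differ only in drawing [B] from [T (dual R K)] or from
     [T (weak_dual R H)]. *)
  rewrite type_closureE; apply/seteqP; split=> chi Hchi B.
    by rewrite regular_weak_dual // => TB B0; exact: Hchi.
  by move=> [TB B0]; apply: Hchi => //; rewrite regular_weak_dual.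
move=> B; rewrite regular_weak_dual // base_image_id => TB B0.
(* For (c), it suffices to test [B] on the evaluations at points of the closure; as [B] lies in
   [null_bases R T H], each of them sends [B] to 0 by (a). *)
apply/base_cvg_weak_dual; first exact: ct_filter_base TB.
by move=> chi; rewrite type_closureE; apply.
Qed.
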